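(* Let $q$ be a prime power and $n\ge1$ an integer. Let $\Psi$ be a transitive automorphism of the projective space $\mathbb{P}^n$ over $\mathbb{F}_q$. For any $P\in\mathbb{P}^n$ and any $d\in\{1,\dots,n-1\}$ there is no $d$-dimensional projective subspace $W$ of $\mathbb{P}^n$ such that $\Psi^i(P)\in W$ for all $i\in\{0,\dots,d+1\}$.
   Context: $\mathbb{P}^n$ denotes the set of $\mathbb{F}_q$-points of $n$-dimensional projective space over $\mathbb{F}_q$; its automorphisms are the elements of $\mathrm{PGL}_{n+1}(\mathbb{F}_q)$. A $d$-dimensional projective subspace is the projectivization of a $(d+1)$-dimensional linear subspace of $\mathbb{F}_q^{n+1}$. A map $f:X\to X$ is transitive if for any $x,y\in X$ there is an integer $i\ge0$ with $y=f^i(x)$. *)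

(* Defs.v *)
From HB Require Import structures.
From mathcomp Require Import all_boot all_order all_algebra all_fingroup.
From mathcomp Require Import center.

Set Implicit Arguments.
Unset Strict Implicit.
Unset Printing Implicit Defensive.

Import GRing.Theory.
Local Open Scope ring_scope.

(* A point of P^n is a line through the origin of the space of column
   vectors, on which matrices act on the left. *)
Record proj_space (F : finFieldType) (n : nat) := ProjPoint {
  line_of :> {vspace 'cV[F]_n.+1};
  dim_line_of : (\dim line_of == 1)%N }.

HB.instance Definition _ F n := [isSub for @line_of F n].
HB.instance Definition _ F n := [Choice of proj_space F n by <:].

Definition pgl (F : finFieldType) (n : nat) :=
  coset_of 'Z('GL_n.+1[F])%g.

Lemma dim_mulmx_line (F : finFieldType) (n : nat) (A : {'GL_n.+1[F]})
    (P : proj_space F n) :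
  (\dim (linfun (mulmx (GLval A)) @: P)%VS == 1)%N.
Proof.
rewrite limg_dim_eq ?dim_line_of //.
suff /eqP -> : lker (linfun (mulmx (GLval A) : 'cV[F]_n.+1 -> _)) == 0%VS.
  by rewrite capv0.
apply/lker0P => u v; rewrite !lfunE /=.
exact: (can_inj (mulKmx (GL_unit A))).
Qed.

Definition gl_act (F : finFieldType) (n : nat) (A : {'GL_n.+1[F]})
    (P : proj_space F n) : proj_space F n :=
  ProjPoint (dim_mulmx_line A P).

(* The automorphism of P^n given by a class of matrices; by pgl_actE below it
   does not depend on the representative. *)
Definition pgl_act (F : finFieldType) (n : nat) (Psi : pgl F n)
    (P : proj_space F n) : proj_space F n :=
  gl_act (repr Psi) P.

Definition transitive_map (X : Type) (f : X -> X) : Prop :=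
  forall x y : X, exists i : nat, y = iter i f x.

Definition projectivization (F : finFieldType) (n : nat)
    (U : {vspace 'cV[F]_n.+1}) : {pred proj_space F n} :=
  [pred P : proj_space F n | (line_of P <= U)%VS].

Definition is_proj_subspace (F : finFieldType) (n d : nat)
    (W : {pred proj_space F n}) : Prop :=
  exists2 U : {vspace 'cV[F]_n.+1}, \dim U = d.+1 & W =i projectivization U.

Lemma center_GL_scalar (F : finFieldType) (n : nat) (A : {'GL_n.+1[F]}) :
  A \in 'Z('GL_n.+1[F])%g -> exists a : F, GLval A = a%:M.
Proof.
case/centerP => _ cA; exists (GLval A 0 0).
have comm (i j : 'I_n.+1) : i != j ->
    GLval A *m delta_mx i j = delta_mx i j *m GLval A.
  move=> ij; pose N : 'M[F]_n.+1 := delta_mx i j.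
  have NN : N * N = 0 by rewrite -mulmxE mul_delta_mx_0 // eq_sym.
  have uB : 1 + N \is a GRing.unit.
    apply/unitrP; exists (1 - N).
    split; first by rewrite mulrBl mul1r mulrDr mulr1 NN addr0 addrK.
    by rewrite mulrDl mul1r mulrBr mulr1 NN subr0 subrK.
  have /(congr1 val) := cA (FinRing.unit _ uB) (in_setT _).
  by rewrite /= mulrDl mulrDr mul1r mulr1 => /addrI.
have offdiag (k i : 'I_n.+1) : k != i -> GLval A k i = 0.
  move=> ki; have /matrixP/(_ k k) := comm i k ltac:(by rewrite eq_sym).
  rewrite !mxE (bigD1 i) //= big1 => [|l li]; last first.
    by rewrite mxE (negbTE li) mulr0.
  rewrite big1 => [|l _]; last by rewrite mxE (negbTE ki) mul0r.
  by rewrite mxE !eqxx mulr1 addr0.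
apply/matrixP => i j; rewrite mxE.
have [<-|/offdiag ->] := eqVneq i j; last by [].
have [->|i0] := eqVneq i 0; first by [].
have /matrixP/(_ i 0) := comm i 0 i0.
rewrite !mxE (bigD1 i) //= big1 => [|l li]; last first.
  by rewrite mxE (negbTE li) mulr0.
rewrite (bigD1 0) //= big1 => [|l l0]; last first.
  by rewrite mxE (negbTE l0) andbF mul0r.
by rewrite !mxE !eqxx mulr1 mul1r !addr0.
Qed.

Lemma pgl_actE (F : finFieldType) (n : nat) (Psi : pgl F n)
    (A : {'GL_n.+1[F]}) (P : proj_space F n) :
  A \in (Psi : {set _}) -> pgl_act Psi P = gl_act A P.
Proof.
move=> PsiA; apply/val_inj/eqP; rewrite eqEdim /=.
rewrite !(eqP (dim_mulmx_line _ _)) leqnn andbT.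
apply/subvP => _ /memv_imgP[v Pv ->].
rewrite -(coset_mem PsiA) val_coset; last first.
  by apply: (subsetP (coset_norm Psi)).
case: repr_rcosetP => z /center_GL_scalar[a za].
rewrite lfunE /= -[_ *m v]/((GLval z *m GLval A) *m v) za mul_scalar_mx -scalemxAl scalemxAr.
by apply/memv_imgP; exists (a *: v); rewrite ?memvZ // lfunE.
Qed.

(* Main.v *)
Require Import Defs.
From mathcomp Require Import all_boot all_order all_algebra all_fingroup.

(** A matrix [A] representing [Psi] acts linearly on the ambient space, and the
    points [Psi^i(P)] are the successive images under [A] of one line [L].
    Suppose that the first [d + 2] of them lie in a subspace [U] of vector
    dimension [d + 1]. Then the whole orbit stays in [U]
    ([iter_limg_trapped]): each extra iterate known to lie in [U] allows [U] to
    be replaced by the smaller [U :&: A^-1 U], still containing an initial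
    segment of the orbit that is one shorter, and this shrinking must stop at
    an [A]-stable subspace before the segment is exhausted. By transitivity
    every point of the projective space then lies in [U], so [U] is the full
    space ([fullv_of_points]), against [d + 1 < n + 1]. *)

Set Implicit Arguments.
Unset Strict Implicit.
Unset Printing Implicit Defensive.

Import GRing.Theory.
Local Open Scope ring_scope.

Lemma limg_subv_preim (K : fieldType) (aT rT : vectType K) (f : 'Hom(aT, rT))
    (X : {vspace aT}) (U : {vspace rT}) :
  (f @: X <= U)%VS = (X <= f @^-1: U)%VS.
Proof.
apply/subvP/subvP => [fXU x Xx | XfU _ /memv_imgP[x Xx ->]].
  by rewrite -memv_preim fXU // memv_img.
by rewrite memv_preim XfU.
Qed.

(** The bound [m] is kept separate from [\dim U] so that the induction can
    lower it together with the dimension: either [U] is stable under [f] and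
    traps everything, or [U :&: f @^-1: U] has smaller dimension and contains
    the iterates of index less than [m], since those and their images lie in
    [U]. *)
Lemma iter_limg_trapped (K : fieldType) (vT : vectType K) (f : 'End(vT))
    (L U : {vspace vT}) (m : nat) :
    (\dim U <= m)%N ->
    (forall i, (i <= m)%N -> (iter i (lfun_img f) L <= U)%VS) ->
  forall i, (iter i (lfun_img f) L <= U)%VS.
Proof.
elim: m U => [|m IHm] U dimU LU i;
    have [stableU | not_stableU] := boolP (U <= f @^-1: U)%VS.
- elim: i => [|i IHi]; first exact: LU.
  by rewrite iterS limg_subv_preim (subv_trans IHi).
- move: dimU not_stableU; rewrite leqn0 dimv_eq0 => /eqP->.
  by rewrite sub0v.
- elim: i => [|i IHi]; first exact: LU.
  by rewrite iterS limg_subv_preim (subv_trans IHi).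
apply: subv_trans (capvSl U (f @^-1: U)); apply: IHm => [|j le_jm].
  rewrite -ltnS; apply: leq_trans dimU.
  rewrite ltn_neqAle dimvS ?capvSl // andbT.
  apply: contra not_stableU => /eqP eq_dim.
  by apply/capv_idPl/eqP; rewrite eqEdim capvSl eq_dim /=.
by rewrite subv_cap LU 1?leqW // -limg_subv_preim -iterS LU.
Qed.

Lemma fullv_of_points (F : finFieldType) (n : nat) (U : {vspace 'cV[F]_n.+1}) :
  (forall Q : proj_space F n, (line_of Q <= U)%VS) -> U = fullv.
Proof.
move=> QU; apply/vspaceP => v; rewrite memvf.
have [->|v0] := eqVneq v 0; first exact: mem0v.
have dimv : (\dim <[v]>%VS == 1)%N by rewrite dim_vline v0.
exact: (QU (ProjPoint dimv)).
Qed.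

Lemma line_of_iter_pgl_act (F : finFieldType) (n : nat) (Psi : pgl F n)
    (P : proj_space F n) (i : nat) :
  line_of (iter i (pgl_act Psi) P) =
  iter i (lfun_img (linfun (mulmx (GLval (repr Psi))))) (line_of P).
Proof. by elim: i => //= i ->. Qed.

Theorem proposition4p1 (F : finFieldType) (n : nat) (n_ge1 : (1 <= n)%N)
    (Psi : pgl F n) (Psi_trans : transitive_map (pgl_act Psi))
    (P : proj_space F n) (d : nat) (d_range : (1 <= d <= n - 1)%N) :
  ~ exists W : {pred proj_space F n},
      is_proj_subspace d W /\
      (forall i : nat, (i <= d.+1)%N -> iter i (pgl_act Psi) P \in W).
Proof.
case=> W [[U dimU WU] PW].
have orbitU i : (line_of (iter i (pgl_act Psi) P) <= U)%VS.
  rewrite line_of_iter_pgl_act.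
  apply: (@iter_limg_trapped _ _ _ _ _ d.+1) => [|j le_jd]; first by rewrite dimU.
  by rewrite -line_of_iter_pgl_act; have := PW j le_jd; rewrite WU inE.
have fullU : U = fullv.
  by apply: fullv_of_points => Q; have [i ->] := Psi_trans P Q.
have {d_range} /andP[_ le_dn] := d_range.
move: dimU; rewrite fullU dimvf dim_matrix mulr1 => -[eq_nd].
by move: le_dn; rewrite -eq_nd subn1 leqNgt ltn_predL n_ge1.
Qed.
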